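(* Let $\mathcal{I}$ be a proper $\sigma$-ideal of subsets of $\mathbb{R}$ which contains all singletons, has a Borel base and is translation invariant. Assume that $\mathcal{I}$ has the weaker Smital property. Then there exists a partition $\mathcal{P}\subseteq\mathcal{I}$ of $\mathbb{R}$ such that for every $\mathcal{A}\subseteq\mathcal{P}$: if $\bigcup\mathcal{A}$ is $\mathcal{I}$-nonmeasurable, then $\bigcup\mathcal{A}$ is completely $\mathcal{I}$-nonmeasurable.
   Context: $\mathcal{I}$ has a Borel base if every $I\in\mathcal{I}$ is contained in some Borel set $B\in\mathcal{I}$. $\mathcal{I}$ is translation invariant if $x+I=\{x+i: i\in I\}\in\mathcal{I}$ for all $I\in\mathcal{I}$ and $x\in\mathbb{R}$. $\mathcal{I}$ has the weaker Smital property if there is a countable dense set $D\subseteq\mathbb{R}$ such that for every Borel set $A\subseteq\mathbb{R}$ with $A\notin\mathcal{I}$, the complement $\mathbb{R}\setminus(A+D)$ belongs to $\mathcal{I}$, where $A+D=\{a+d: a\in A, d\in D\}$. A set $A\subseteq\mathbb{R}$ is $\mathcal{I}$-nonmeasurable if it does not belong to the $\sigma$-algebra generated by the Borel sets and $\mathcal{I}$. It is completely $\mathcal{I}$-nonmeasurable if $A\cap B$ is $\mathcal{I}$-nonmeasurable for every Borel set $B\notin\mathcal{I}$. A partition of $\mathbb{R}$ is a family of nonempty pairwise disjoint sets with union $\mathbb{R}$. *)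

(* Defs.v *)
From mathcomp Require Import all_boot all_order all_algebra.
From mathcomp Require Import boolp classical_sets functions cardinality reals.
From mathcomp Require Import topology normedtype measure.
From mathcomp Require Import lebesgue_stieltjes_measure lebesgue_measure.
Set Implicit Arguments.
Unset Strict Implicit.
Unset Printing Implicit Defensive.
Import Order.TTheory GRing.Theory Num.Theory.
Import numFieldNormedType.Exports.
Local Open Scope classical_set_scope.
Local Open Scope ring_scope.

(* The canonical sigma-algebra of a realType is generated by the half-open
   intervals; its members are exactly the Borel sets. *)
Definition borel (R : realType) : set (set R) := @measurable _ R.

Definition sigma_ideal (T : Type) (I : set (set T)) : Prop :=
  [/\ I set0,
      forall A B : set T, B `<=` A -> I A -> I B
    & forall F : nat -> set T, (forall n, I (F n)) -> I (\bigcup_n F n)].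

Definition has_borel_base (R : realType) (I : set (set R)) : Prop :=
  forall A, I A -> exists B, [/\ borel B, I B & A `<=` B].

Definition translation_invariant (R : realType) (I : set (set R)) : Prop :=
  forall (A : set R) (x : R), I A -> I [set x + a | a in A].

Definition weaker_smital (R : realType) (I : set (set R)) : Prop :=
  exists D : set R, [/\ countable D, dense D
    & forall A : set R, borel A -> ~ I A ->
        I (~` [set a + d | a in A & d in D])].

Definition nonmeasurable (R : realType) (I : set (set R)) (A : set R) : Prop :=
  ~ <<s @borel R `|` I >> A.

Definition completely_nonmeasurable (R : realType) (I : set (set R))
    (A : set R) : Prop :=
  forall B : set R, borel B -> ~ I B -> nonmeasurable I (A `&` B).

(* Main.v *)
Require Import Defs.
From mathcomp Require Import all_boot all_order all_algebra.
From mathcomp Require Import boolp classical_sets functions cardinality reals.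
From mathcomp Require Import topology normedtype measure.
From mathcomp Require Import lebesgue_stieltjes_measure lebesgue_measure.
Local Open Scope classical_set_scope.

Import GRing.Theory.

(** The partition consists of the cosets of the countable subgroup [G]
    generated by a countable set [D] witnessing the weaker Smital property
    ([countable_sub_subgroup]).  Cosets of [G] are countable, hence in the ideal
    ([countable_sigma_ideal]).

    Both a union [U] of cosets and its complement are invariant under
    translation by [G].  The Smital property gives a zero-one law for such sets:
    if an invariant set [U] contains a Borel set [C] outside the ideal, then it
    contains [C + D], so that its complement lies in the ideal
    ([smital_invariant]).  Suppose that the trace of [U] on some Borel set [B]
    outside the ideal is measurable.  Up to a set of the ideal this trace is
    Borel ([measurable_sandwich]), so either [U] or its complement contains a
    Borel set outside the ideal: a Borel kernel of [U `&` B] if that is not in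
    the ideal, and otherwise [B] minus a Borel hull of [U `&` B].  In both cases
    the zero-one law puts [U] or its complement in the ideal, and [U] is
    measurable. *)

(** The subgroup generated by [D] is countable because each of its elements is
    a difference of two finite sums of elements of [D], and there are countably
    many pairs of finite sequences. *)
Lemma countable_sub_subgroup (V : zmodType) (D : set V) : countable D ->
  exists G : set V, [/\ countable G, D `<=` G, G 0%R
    & forall x y, G x -> G y -> G (x - y)%R].
Proof.
case/pfcard_geP=> [->|[f]].
  by exists [set 0%R]; split => // x y -> ->; rewrite subr0.
pose comb (p : seq nat * seq nat) :=
  (\sum_(i <- p.1) f i - \sum_(i <- p.2) f i)%R.
exists (range comb); split.
- apply: sub_countable (countableP [set: seq nat * seq nat]).
  exact: card_image_le.
- move=> d /(@surj _ _ _ _ f)[n _ <-]; exists ([:: n], [::]) => //.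
  by rewrite /comb/= big_seq1 big_nil subr0.
- by exists ([::], [::]) => //; rewrite /comb/= !big_nil subr0.
- move=> _ _ [[s t] _ <-] [[s' t'] _ <-]; exists (s ++ t', t ++ s') => //.
  by rewrite /comb/= !big_cat/= opprB opprD addrACA.
Qed.

Lemma countable_sigma_ideal (T : Type) (I : set (set T)) (A : set T) :
  sigma_ideal I -> (forall x, I [set x]) -> countable A -> I A.
Proof.
move=> [I0 Isub Ibig] I1 /pfcard_geP[->//|[f]].
apply: (Isub (\bigcup_n [set f n])); last by apply: Ibig => n; exact: I1.
by move=> x /(@surj _ _ _ _ f)[n _ <-]; exists n.
Qed.

Lemma sigma_idealU {T : Type} {I : set (set T)} {A B : set T} :
  sigma_ideal I -> I A -> I B -> I (A `|` B).
Proof.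
move=> [I0 Isub Ibig] IA IB.
apply: (Isub (\bigcup_n if n is 0 then A else B)).
  by move=> x [Ax|Bx]; [exists 0|exists 1].
by apply: Ibig => -[|n].
Qed.

(** The sets enclosed between two Borel sets whose difference is in [I] form
    a sigma-algebra, the completion of the Borel sets by [I].  A Borel base is
    what makes it contain [I]: a set of [I] lies between the empty set and
    a Borel set of [I]. *)
Lemma measurable_sandwich (R : realType) (I : set (set R)) (E : set R) :
  sigma_ideal I -> has_borel_base I -> <<s @borel R `|` I >> E ->
  exists K H : set R,
    [/\ borel K, borel H, K `<=` E, E `<=` H & I (H `\` K)].
Proof.
move=> [I0 Isub Ibig] Ibase; move: E.
apply: smallest_sub; last first.
  move=> E [bE|/Ibase[H [bH IH EH]]].
    by exists E, E; split => //; rewrite setDv.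
  by exists set0, H; split => //; [exact: measurable0|rewrite setD0].
split.
- by exists set0, set0; split => //; rewrite ?setD0//; exact: measurable0.
- move=> E [K [H [bK bH KE EH IHK]]]; rewrite setTD.
  exists (~` H), (~` K); split; try exact: measurableC; try exact: subsetC.
  by rewrite setDE setCK setIC -setDE.
- move=> F /choice[K /choice[H KH]].
  exists (\bigcup_n K n), (\bigcup_n H n); split.
  + by apply: bigcupT_measurable => n; have [] := KH n.
  + by apply: bigcupT_measurable => n; have [] := KH n.
  + by apply: subset_bigcup => n _; have [] := KH n.
  + by apply: subset_bigcup => n _; have [] := KH n.
  + apply: (Isub (\bigcup_n (H n `\` K n))).
      move=> x [[n _ Hnx] Kx]; exists n => //.
      by split => // Knx; apply: Kx; exists n.
    by apply: Ibig => n; have [] := KH n.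
Qed.

(** The zero-one law: translates of [C] by elements of [D] stay inside an
    invariant set containing [C], and together they already fill the line up to
    a set of the ideal. *)
Lemma smital_invariant (R : realType) (I : set (set R)) (D U C : set R) :
  sigma_ideal I ->
  (forall A : set R, borel A -> ~ I A ->
     I (~` [set a + d | a in A & d in D]%R)) ->
  (forall x d, U x -> D d -> U (x + d)%R) ->
  borel C -> ~ I C -> C `<=` U -> I (~` U).
Proof.
move=> [_ Isub _] smital invU bC nIC CU.
apply: (Isub _ _ _ (smital C bC nIC)); apply: subsetC => _ [c Cc [d Dd <-]].
by apply: invU => //; exact: CU.
Qed.

(** For an invariant set, measurability on one Borel piece outside the ideal
    forces the set or its complement into the ideal, hence measurability on the
    whole line.  The invariance of the complement is a separate hypothesis because [D] need
    not be symmetric. *)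
Lemma invariant_completely_nonmeasurable (R : realType) (I : set (set R))
    (D U : set R) :
  sigma_ideal I -> has_borel_base I ->
  (forall A : set R, borel A -> ~ I A ->
     I (~` [set a + d | a in A & d in D]%R)) ->
  (forall x d, U x -> D d -> U (x + d)%R) ->
  (forall x d, (~` U) x -> D d -> (~` U) (x + d)%R) ->
  nonmeasurable I U -> completely_nonmeasurable I U.
Proof.
move=> Isig Ibase smital invU invUC nmU B bB nIB mUB.
have [_ Isub _] := Isig.
have nIU : ~ I U by move=> IU; apply: nmU; apply: sub_gen_smallest; right.
have nIUC : ~ I (~` U).
  move=> IUC; apply: nmU; rewrite -(setCK U) -setTD.
  by apply: (sigma_algebraCD _); apply: sub_gen_smallest; right.
have [K [H [bK bH KUB UBH IHK]]] :=
  measurable_sandwich _ _ _ Isig Ibase mUB.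
have IK : I K.
  apply: contrapT => nIK; apply: nIUC.
  apply: (smital_invariant _ _ _ _ K Isig smital invU) => //.
  exact: subset_trans KUB (@subIsetl _ _ _).
have IH : I H.
  apply: (Isub _ _ _ (sigma_idealU Isig IHK IK)) => x Hx.
  by have [Kx|nKx] := pselect (K x); [right|left].
apply: nIU; rewrite -(setCK U).
apply: (smital_invariant _ _ _ _ (B `\` H) Isig smital invUC).
- exact: measurableD.
- move=> IBH; apply: nIB.
  apply: (Isub _ _ _ (sigma_idealU Isig IBH IH)) => x Bx.
  by have [Hx|nHx] := pselect (H x); [right|left].
- by move=> x [Bx nHx] Ux; apply: nHx; apply: UBH.
Qed.

Theorem theorem3p3 (R : realType) (I : set (set R))
    (I_sigma : sigma_ideal I) (I_proper : ~ I [set: R])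
    (I_singletons : forall x : R, I [set x])
    (I_borel_base : has_borel_base I)
    (I_translation : translation_invariant I)
    (I_smital : weaker_smital I) :
  exists P : set (set R),
    [/\ classical_sets.partition P id [set: R],
        P `<=` I
      & forall A : set (set R), A `<=` P ->
          nonmeasurable I (\bigcup_(X in A) X) ->
          completely_nonmeasurable I (\bigcup_(X in A) X)].
Proof.
have [D [cD _ smital]] := I_smital.
have [G [cG DG G0 GB]] := countable_sub_subgroup _ _ cD.
have GN g : G g -> G (- g)%R by move=> Gg; rewrite -sub0r; exact: GB.
have GD g h : G g -> G h -> G (g + h)%R.
  by move=> Gg Gh; rewrite -(opprK h); apply: GB => //; exact: GN.
pose coset (x : R) := [set y | G (y - x)%R].
have coset_eq x y z : coset x z -> coset y z -> coset x = coset y.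
  move=> xz yz; apply/seteqP; split => t; rewrite /coset/= => Gt.
    have -> : (t - y = (t - x) - (z - x) + (z - y))%R by rewrite opprB !addrA !subrK.
    by apply: GD => //; exact: GB.
  have -> : (t - x = (t - y) - (z - y) + (z - x))%R by rewrite opprB !addrA !subrK.
  by apply: GD => //; exact: GB.
have coset_refl x : coset x x by rewrite /coset/= subrr.
have coset_shift x y g : G g -> coset x (y + g)%R <-> coset x y.
  move=> Gg; split; rewrite /coset/= addrAC => Gy; last exact: GD.
  by rewrite -(addrK g (y - x)%R); exact: GB.
exists (range coset); split.
- split.
  + by rewrite -subTset => x _; exists (coset x) => //; exists x.
  + by move=> _ _ [x _ <-] [y _ <-] [z [xz yz]]; exact: coset_eq xz yz.
  + by move=> _ [x _ <-]; exists x.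
- move=> _ [x _ <-]; apply: countable_sigma_ideal => //.
  apply: (sub_countable _ cG); apply: card_le_trans (card_image_le (+%R x) G).
  by apply: subset_card_le => y Gy; exists (y - x)%R => //; rewrite subrKC.
- move=> A AP.
  apply: (invariant_completely_nonmeasurable _ _ _ _ I_sigma I_borel_base smital).
  + move=> y d [X AX Xy] /DG Gd; exists X => //.
    by have [x _ eX] := AP _ AX; move: Xy; rewrite -eX => /(coset_shift _ _ _ Gd).
  + move=> y d nUy /DG Gd [X AX Xy]; apply: nUy; exists X => //.
    by have [x _ eX] := AP _ AX; move: Xy; rewrite -eX => /(coset_shift _ _ _ Gd).
Qed.
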